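(* Let $\mathfrak a=(\mathfrak H,\mathfrak A,\mathfrak A^\dagger)$, $\mathfrak b=(\mathfrak K,\mathfrak B,\mathfrak B^\dagger)$, $\mathfrak c=(\mathfrak L,\mathfrak C,\mathfrak C^\dagger)$ be $C^*$-bases, let ${}_\alpha H_\beta$ be a $C^*$-$(\mathfrak a^\dagger,\mathfrak b)$-module and ${}_\gamma K_\delta$ a $C^*$-$(\mathfrak b^\dagger,\mathfrak c)$-module. Put $$\alpha\lhd\gamma:=[\,|\gamma\rangle_2\alpha\,]\subseteq\mathcal L(\mathfrak H,H\otimes_{\mathfrak b}K),\qquad \beta\rhd\delta:=[\,|\beta\rangle_1\delta\,]\subseteq\mathcal L(\mathfrak L,H\otimes_{\mathfrak b}K).$$ Then ${}_{(\alpha\lhd\gamma)}(H\otimes_{\mathfrak b}K)_{(\beta\rhd\delta)}$ is a $C^*$-$(\mathfrak a^\dagger,\mathfrak c)$-module, and $$\rho_{(\alpha\lhd\gamma)}(x)=\rho_\alpha(x)\otimes\mathrm{id}\ \text{ for all }x\in(\mathfrak A^\dagger)',\qquad \rho_{(\beta\rhd\delta)}(y)=\mathrm{id}\otimes\rho_\delta(y)\ \text{ for all }y\in\mathfrak C'.$$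
   Context: Notation: $[Y]$ is the closed linear span of a subset $Y$ of a normed space; for sets of operators, $XY=\{xy\}$, $X^*=\{x^*\}$, and $X'$ is the commutant. A $C^*$-base $\mathfrak b=(\mathfrak K,\mathfrak B,\mathfrak B^\dagger)$ consists of a Hilbert space $\mathfrak K$ and two nondegenerate $C^*$-algebras $\mathfrak B,\mathfrak B^\dagger\subseteq\mathcal L(\mathfrak K)$ that commute with each other elementwise; its opposite is $\mathfrak b^\dagger=(\mathfrak K,\mathfrak B^\dagger,\mathfrak B)$. A $C^*$-$\mathfrak b$-module $H_\beta=(H,\beta)$ is a Hilbert space $H$ with a closed subspace $\beta\subseteq\mathcal L(\mathfrak K,H)$ such that $[\beta\mathfrak K]=H$, $[\beta\mathfrak B]=\beta$, $[\beta^*\beta]=\mathfrak B$. There is then a unique normal unital faithful representation $\rho_\beta:\mathfrak B'\to\mathcal L(H)$ with $\rho_\beta(x)\xi\zeta=\xi x\zeta$ for $x\in\mathfrak B'$, $\xi\in\beta$, $\zeta\in\mathfrak K$. (For a $C^*$-$\mathfrak b^\dagger$-module $K_\gamma$, this means $\gamma\subseteq\mathcal L(\mathfrak K,K)$, $[\gamma^*\gamma]=\mathfrak B^\dagger$ etc., and $\rho_\gamma$ is defined on $(\mathfrak B^\dagger)'\supseteq\mathfrak B$.) A $C^*$-$(\mathfrak a^\dagger,\mathfrak b)$-module ${}_\alpha H_\beta=(H,\alpha,\beta)$ is a Hilbert space $H$ such that $(H,\alpha)$ is a $C^*$-$\mathfrak a^\dagger$-module, $(H,\beta)$ is a $C^*$-$\mathfrak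 b$-module, $[\rho_\alpha(\mathfrak A)\beta]=\beta$ and $[\rho_\beta(\mathfrak B^\dagger)\alpha]=\alpha$. Relative tensor product: for a $C^*$-$\mathfrak b$-module $H_\beta$ and a $C^*$-$\mathfrak b^\dagger$-module $K_\gamma$, $H\otimes_{\mathfrak b}K$ (depending on $\beta,\gamma$) is the Hilbert space obtained as separated completion of the algebraic tensor product $\beta\odot\mathfrak K\odot\gamma$ with respect to $\langle\xi\odot\zeta\odot\eta|\xi'\odot\zeta'\odot\eta'\rangle=\langle\zeta|\xi^*\xi'\eta^*\eta'\zeta'\rangle$; the image of $\xi\odot\zeta\odot\eta$ is written $\xi\otimes\zeta\otimes\eta$. For $\xi\in\beta$, $\eta\in\gamma$ there are bounded operators $|\xi\rangle_1:K\to H\otimes_{\mathfrak b}K$, $\eta\zeta\mapsto\xi\otimes\zeta\otimes\eta$, and $|\eta\rangle_2:H\to H\otimes_{\mathfrak b}K$, $\xi\zeta\mapsto\xi\otimes\zeta\otimes\eta$; $|\beta\rangle_1=\{|\xi\rangle_1:\xi\in\beta\}$, $|\gamma\rangle_2=\{|\eta\rangle_2:\eta\in\gamma\}$. For $S\in\rho_\beta(\mathfrak B^\dagger)'\subseteq\mathcal L(H)$, $S\otimes\mathrm{id}$ is the unique operator on $H\otimes_{\mathfrak b}K$ with $(S\otimes\mathrm{id})|\eta\rangle_2=|\eta\rangle_2S$ for all $\eta\in\gamma$; for $T\in\rho_\gamma(\mathfrak B)'\subseteq\mathcal L(K)$, $\mathrm{id}\otimes T$ is the unique operator with $(\mathrm{id}\otimes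 T)|\xi\rangle_1=|\xi\rangle_1T$ for all $\xi\in\beta$. *)

(* Defs.v *)
From HB Require Import structures.
From mathcomp Require Import all_boot all_order all_algebra.
From mathcomp Require Import complex.
From mathcomp Require Import all_classical all_reals all_analysis.

Set Implicit Arguments.
Unset Strict Implicit.
Unset Printing Implicit Defensive.

Import Order.TTheory GRing.Theory Num.Theory.
Import numFieldNormedType.Exports.

Local Open Scope classical_set_scope.
Local Open Scope ring_scope.
Local Open Scope complex_scope.

(* Complex scalars are R[i]; the inner product is linear in its second argument. *)
HB.mixin Record CompleteNormedModule_isHilbert (R : realType) H
    & CompleteNormedModule R[i] H := {
  inner : H -> H -> R[i];
  innerPr : forall (a : R[i]) (x y z : H),
    inner x (a *: y + z) = a * inner x y + inner x z;
  inner_conj : forall x y : H, inner y x = (inner x y)^*%R;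
  inner_norm : forall x : H, inner x x = `|x| ^+ 2
}.

#[short(type="hilbertType")]
HB.structure Definition Hilbert (R : realType) :=
  {H of CompleteNormedModule R[i] H & CompleteNormedModule_isHilbert R H}.

Section LinearSpan.
Variables (K : numFieldType) (V : normedModType K).
Implicit Types Y : set V.

Definition is_subspace Y :=
  Y 0 /\ forall (a : K) u v, Y u -> Y v -> Y (a *: u + v).

Definition linear_span Y : set V :=
  [set v | exists n (a : 'I_n -> K) (y : 'I_n -> V),
     (forall i, Y (y i)) /\ v = \sum_(i < n) a i *: y i].

Definition closed_span Y : set V := closure (linear_span Y).

End LinearSpan.

Section BoundedOperators.
Variables (R : realType) (H K : normedModType R[i]).

Definition bounded_linear : {pred H -> K} :=
  mem [set f : H -> K | linear f /\
    exists M : R, forall x, `|f x| <= M%:C * `|x|].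

Lemma bounded_linear_submod : submod_closed bounded_linear.
Proof.
split=> [|a f g]; rewrite ?inE /=.
  split=> [b x y|]; first by rewrite scaler0 addr0.
  by exists 0 => x; rewrite normr0 mul0r.
move=> [fl [M fM]] [gl [N gN]]; split=> [b x y|].
  rewrite /= !fctE fl gl !scalerDr !scalerA (mulrC a).
  by rewrite !addrA; congr (_ + _); rewrite -!addrA; congr (_ + _); rewrite addrC.
exists (complex.Re `|a| * M + N) => x; rewrite !fctE.
apply: le_trans (ler_normD _ _) _.
rewrite normrZ rmorphD rmorphM /= mulrDl -mulrA.
rewrite (_ : (complex.Re `|a|)%:C = `|a|); last exact/RRe_real/normr_real.
by rewrite lerD// ler_wpM2l.
Qed.

HB.instance Definition _ :=
  GRing.isSubmodClosed.Build R[i] (H -> K) bounded_linear bounded_linear_submod.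

Record boundedOp := BoundedOp {
  boundedOp_fun :> H -> K;
  boundedOpP : boundedOp_fun \in bounded_linear }.

HB.instance Definition _ := [isSub for boundedOp_fun].
HB.instance Definition _ := [Choice of boundedOp by <:].
HB.instance Definition _ := [SubChoice_isSubLmodule of boundedOp by <:].

Implicit Types T S : boundedOp.

Lemma boundedOp_linear T : linear T.
Proof. by move: (boundedOpP T); rewrite inE => -[]. Qed.

HB.instance Definition _ T :=
  GRing.isLinear.Build R[i] H K *:%R T (boundedOp_linear T).

Definition opnorm T : R :=
  inf [set M : R | 0 <= M /\ forall x, `|T x| <= M%:C * `|x|].

Let normC (V : normedModType R[i]) (x : V) : `|x| = (complex.Re `|x|)%:C.
Proof. by apply/esym/RRe_real/normr_real. Qed.

Lemma opnorm_has_inf T :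
  has_inf [set M : R | 0 <= M /\ forall x, `|T x| <= M%:C * `|x|].
Proof.
split; last by exists 0 => M [].
move: (boundedOpP T); rewrite inE => -[_ [M TM]].
exists `|M|; split=> // x; apply: le_trans (TM x) _.
by rewrite ler_wpM2r// lecR ler_norm.
Qed.

Lemma opnorm_ge0 T : 0 <= opnorm T.
Proof. by apply: lb_le_inf; [case: (opnorm_has_inf T)|move=> M []]. Qed.

Lemma opnorm_bound T x : `|T x| <= (opnorm T)%:C * `|x|.
Proof.
have [->|x0] := eqVneq x 0; first by rewrite linear0 !normr0 mulr0.
have nx0 : 0 < complex.Re `|x|.
  by rewrite -ltcR -normC rmorph0 normr_gt0.
rewrite (normC (T x)) (normC x) -rmorphM lecR -ler_pdivrMr//.
apply: lb_le_inf; first by case: (opnorm_has_inf T).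
move=> M [_ TM]; rewrite ler_pdivrMr// -lecR rmorphM /= -!normC.
exact: TM.
Qed.

Lemma opnorm_le T (M : R) :
  0 <= M -> (forall x, `|T x| <= M%:C * `|x|) -> opnorm T <= M.
Proof. by move=> M0 TM; apply: ge_inf => //; case: (opnorm_has_inf T). Qed.

Let norm T : R[i] := (opnorm T)%:C.

Let ler_normD_op T S : norm (T + S) <= norm T + norm S.
Proof.
rewrite /norm -rmorphD lecR; apply: opnorm_le => [|x].
  by rewrite addr_ge0// opnorm_ge0.
rewrite rmorphD mulrDl; apply: le_trans (ler_normD _ _) _.
by rewrite lerD// opnorm_bound.
Qed.

Let opnormZ_le (a : R[i]) T : opnorm (a *: T) <= complex.Re `|a| * opnorm T.
Proof.
have na : `|a| = (complex.Re `|a|)%:C by apply/esym/RRe_real/normr_real.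
apply: opnorm_le => [|x].
  rewrite mulr_ge0 ?opnorm_ge0// -lecR -na; exact: normr_ge0.
rewrite normrZ rmorphM /= -na -mulrA ler_wpM2l//.
exact: opnorm_bound.
Qed.

Let normZ_op (a : R[i]) T : norm (a *: T) = `|a| * norm T.
Proof.
have na (b : R[i]) : `|b| = (complex.Re `|b|)%:C.
  by apply/esym/RRe_real/normr_real.
rewrite /norm na -rmorphM; congr _%:C.
apply/eqP; rewrite eq_le opnormZ_le andTb.
have [->|a0] := eqVneq a 0; first
  by rewrite normr0 [complex.Re _]/= mul0r opnorm_ge0.
have ra0 : 0 < complex.Re `|a| by rewrite -ltcR -na rmorph0 normr_gt0.
rewrite -ler_pdivlMl//; have := opnormZ_le a^-1 (a *: T).
rewrite scalerA mulVf// scale1r => /le_trans; apply.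
suff -> : complex.Re `|a^-1| = (complex.Re `|a|)^-1 by [].
by apply: complexI; rewrite -na fmorphV /= -na normfV.
Qed.

Let norm_op_eq0 T : norm T = 0 -> T = 0.
Proof.
move=> T0; apply/val_inj/funext => x /=; apply/eqP.
rewrite -normr_le0 (le_trans (opnorm_bound T x))//.
by move: T0; rewrite /norm => ->; rewrite mul0r.
Qed.

HB.instance Definition _ := Lmodule_isNormed.Build R[i] boundedOp
  ler_normD_op normZ_op norm_op_eq0.

End BoundedOperators.

Section Composition.
Variables (R : realType) (H K L : normedModType R[i]).

Lemma bcomp_subproof (S : boundedOp K L) (T : boundedOp H K) :
  (S : K -> L) \o T \in @bounded_linear R H L.
Proof.
rewrite inE; split=> [a x y|]; first by rewrite /= !linearP.
exists (opnorm S * opnorm T) => x /=; apply: le_trans (opnorm_bound S _) _.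
by rewrite rmorphM -mulrA ler_wpM2l ?lecR ?opnorm_ge0// opnorm_bound.
Qed.

Definition bcomp S T : boundedOp H L := BoundedOp (bcomp_subproof S T).

Definition opmul (X : set (boundedOp K L)) (Y : set (boundedOp H K)) :
  set (boundedOp H L) := [set bcomp S T | S in X & T in Y].

Definition opapply (X : set (boundedOp H K)) : set K :=
  [set T x | T in X & x in [set: H]].

End Composition.

Section HilbertOperators.
Variables (R : realType) (H K : hilbertType R).

(* [xget] selects the adjoint, which exists and is unique. *)
Definition adjoint (T : boundedOp H K) : boundedOp K H :=
  xget 0 [set S : boundedOp K H | forall x y, inner (T x) y = inner x (S y)].

Definition adjoints (X : set (boundedOp H K)) : set (boundedOp K H) :=
  adjoint @` X.

End HilbertOperators.

Section OperatorAlgebras.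
Variables (R : realType) (H : hilbertType R).

Definition commutant (X : set (boundedOp H H)) : set (boundedOp H H) :=
  [set T | forall S, X S -> bcomp T S = bcomp S T].

Definition nondegenerate_Cstar_algebra (A : set (boundedOp H H)) :=
  [/\ is_subspace A, closed A, opmul A A `<=` A, adjoints A `<=` A
    & closed_span (opapply A) = setT].

End OperatorAlgebras.

Record CstarBase (R : realType) := MkCstarBase {
  base_space :> hilbertType R;
  base_alg : set (boundedOp base_space base_space);
  base_opp_alg : set (boundedOp base_space base_space);
  base_algP : nondegenerate_Cstar_algebra base_alg;
  base_opp_algP : nondegenerate_Cstar_algebra base_opp_alg;
  base_commute : forall S T, base_alg S -> base_opp_alg T ->
    bcomp S T = bcomp T S
}.

Arguments base_alg {R} c.
Arguments base_opp_alg {R} c.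

Definition opposite (R : realType) (b : CstarBase R) : CstarBase R :=
  MkCstarBase (base_opp_algP b) (base_algP b)
    (fun S T hS hT => esym (base_commute hT hS)).

Definition is_Cstar_module (R : realType) (b : CstarBase R)
    (H : hilbertType R) (beta : set (boundedOp b H)) :=
  [/\ is_subspace beta, closed beta,
      closed_span (opapply beta) = setT,
      closed_span (opmul beta (base_alg b)) = beta
    & closed_span (opmul (adjoints beta) beta) = base_alg b].

Arguments is_Cstar_module {R} b {H} beta.

(* For a module (H, beta) and x in the commutant of the algebra of the base,
   the operator determined by rho(x) xi zeta = xi x zeta exists and is unique,
   since [beta K] = H. *)
Definition rho (R : realType) (K H : hilbertType R)
    (beta : set (boundedOp K H)) (x : boundedOp K K) : boundedOp H H :=
  xget 0 [set T : boundedOp H H | forall xi, beta xi -> bcomp T xi = bcomp xi x].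

(* (H, alpha, beta) is a C*-(a^dagger, b)-module: the base of alpha is the
   opposite of [a]. *)
Definition is_Cstar_bimodule (R : realType) (a b : CstarBase R)
    (H : hilbertType R) (alpha : set (boundedOp a H))
    (beta : set (boundedOp b H)) :=
  [/\ is_Cstar_module (opposite a) alpha,
      is_Cstar_module b beta,
      closed_span (opmul (rho alpha @` base_alg a) beta) = beta
    & closed_span (opmul (rho beta @` base_opp_alg b) alpha) = alpha].

(* A separated completion of the algebraic tensor product of beta, b and gamma:
   a linear map out of the algebraic tensor product is a trilinear map, so the
   data are a Hilbert space and a trilinear map into it which takes the given
   form to the inner product and whose range spans a dense subspace.  This
   determines the space up to a unique unitary compatible with the maps.  The
   values of [tens] outside beta and gamma are irrelevant. *)
Record relTensor (R : realType) (b : CstarBase R) (H K : hilbertType R)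
    (beta : set (boundedOp b H)) (gamma : set (boundedOp b K)) := MkRelTensor {
  relTensor_space :> hilbertType R;
  tens : boundedOp b H -> b -> boundedOp b K -> relTensor_space;
  tens_linear1 : forall (c : R[i]) xi xi' zeta eta,
    beta xi -> beta xi' -> gamma eta ->
    tens (c *: xi + xi') zeta eta = c *: tens xi zeta eta + tens xi' zeta eta;
  tens_linear2 : forall (c : R[i]) xi zeta zeta' eta,
    beta xi -> gamma eta ->
    tens xi (c *: zeta + zeta') eta = c *: tens xi zeta eta + tens xi zeta' eta;
  tens_linear3 : forall (c : R[i]) xi zeta eta eta',
    beta xi -> gamma eta -> gamma eta' ->
    tens xi zeta (c *: eta + eta') = c *: tens xi zeta eta + tens xi zeta eta';
  inner_tens : forall xi xi' zeta zeta' eta eta',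
    beta xi -> beta xi' -> gamma eta -> gamma eta' ->
    inner (tens xi zeta eta) (tens xi' zeta' eta') =
    inner zeta (adjoint xi (xi' (adjoint eta (eta' zeta'))));
  tens_total :
    closed_span [set w | exists xi zeta eta,
      [/\ beta xi, gamma eta & w = tens xi zeta eta]] = setT
}.

Section RelativeTensorProduct.
Variables (R : realType) (b : CstarBase R) (H K : hilbertType R).
Variables (beta : set (boundedOp b H)) (gamma : set (boundedOp b K)).
Variable HK : relTensor beta gamma.

Definition ket1 (xi : boundedOp b H) : boundedOp K HK :=
  xget 0 [set T : boundedOp K HK |
    forall eta zeta, gamma eta -> T (eta zeta) = tens HK xi zeta eta].

Definition ket2 (eta : boundedOp b K) : boundedOp H HK :=
  xget 0 [set T : boundedOp H HK |
    forall xi zeta, beta xi -> T (xi zeta) = tens HK xi zeta eta].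

(* S (x) id and id (x) T, for S and T in the indicated commutants only. *)
Definition op_tens_id (S : boundedOp H H) : boundedOp HK HK :=
  xget 0 [set U : boundedOp HK HK |
    commutant (rho beta @` base_opp_alg b) S /\
    forall eta, gamma eta -> bcomp U (ket2 eta) = bcomp (ket2 eta) S].

Definition id_tens_op (T : boundedOp K K) : boundedOp HK HK :=
  xget 0 [set U : boundedOp HK HK |
    commutant (rho gamma @` base_alg b) T /\
    forall xi, beta xi -> bcomp U (ket1 xi) = bcomp (ket1 xi) T].

Definition ltensor (L : hilbertType R) (alpha : set (boundedOp L H)) :
    set (boundedOp L HK) :=
  closed_span (opmul (ket2 @` gamma) alpha).

Definition rtensor (L : hilbertType R) (delta : set (boundedOp L K)) :
    set (boundedOp L HK) :=
  closed_span (opmul (ket1 @` beta) delta).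

End RelativeTensorProduct.

Arguments ket1 {R b H K beta gamma} HK xi.
Arguments ket2 {R b H K beta gamma} HK eta.
Arguments op_tens_id {R b H K beta gamma} HK S.
Arguments id_tens_op {R b H K beta gamma} HK T.
Arguments ltensor {R b H K beta gamma} HK {L} alpha.
Arguments rtensor {R b H K beta gamma} HK {L} delta.

(* Main.v *)
Require Import Defs.
From HB Require Import structures.
From mathcomp Require Import all_boot all_order all_algebra.
From mathcomp Require Import complex.
From mathcomp Require Import all_classical all_reals all_analysis.
From mathcomp Require Import ring lra.

(* The operator |eta>_2 exists because the Gram matrix of the vectors
   xi (x) zeta (x) eta is that of the vectors xi zeta twisted by
   rho_beta(eta^* eta); hence |eta>_2^* |eta'>_2 = rho_beta(eta^* eta').
   Consequently [(alpha <| gamma)^* (alpha <| gamma)] =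
   [alpha^* rho_beta(B^dagger) alpha] = [alpha^* alpha] = A^dagger, and
   rho_(alpha <| gamma)(x) acts by |eta>_2 alpha |-> |eta>_2 rho_alpha(x) alpha,
   which is rho_alpha(x) (x) id and satisfies
   rho_(alpha <| gamma)(x) |xi>_1 = |rho_alpha(x) xi>_1.  The statements on
   beta |> delta are the same ones for the flipped tensor product of gamma and
   beta over the opposite base. *)

Set Implicit Arguments.
Unset Strict Implicit.
Unset Printing Implicit Defensive.

Import Order.TTheory GRing.Theory Num.Theory.
Import numFieldNormedType.Exports.

Local Open Scope classical_set_scope.
Local Open Scope ring_scope.
Local Open Scope complex_scope.

(** * Real-valued norms, closure and completeness *)

Section RealNorm.
Variable (R : realType).

Lemma gt0_complexP (e : R[i]) : 0 < e -> exists2 r : R, 0 < r & e = r%:C.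
Proof.
move=> e0; have eE := RRe_real (gtr0_real e0).
by exists (complex.Re e) => //; rewrite -ltcR eE.
Qed.

Variable V : normedModType R[i].
Implicit Types (x y : V) (A : set V).

(** The norm lives in [R[i]]; its real part lives in [R], where the order is total and [nra] and
    [lra] apply. *)
Definition rnorm x : R := complex.Re `|x|.

Lemma rnormE x : `|x| = (rnorm x)%:C.
Proof. exact/esym/RRe_real/normr_real. Qed.

Lemma rnorm_ge0 x : 0 <= rnorm x.
Proof. by rewrite -lecR -rnormE normr_ge0. Qed.

Lemma rnorm_eq0 x : rnorm x = 0 -> x = 0.
Proof. by move=> x0; apply/eqP; rewrite -normr_eq0 rnormE x0. Qed.

Lemma rnorm0 : rnorm 0 = 0.
Proof. by rewrite /rnorm normr0. Qed.

Lemma rnormN x : rnorm (- x) = rnorm x.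
Proof. by rewrite /rnorm normrN. Qed.

Lemma rnormBC x y : rnorm (x - y) = rnorm (y - x).
Proof. by rewrite -rnormN opprB. Qed.

Lemma rnormD x y : rnorm (x + y) <= rnorm x + rnorm y.
Proof. by rewrite -lecR rmorphD /= -!rnormE ler_normD. Qed.

Lemma closureP A x :
  closure A x <-> forall e : R, 0 < e -> exists2 y, A y & rnorm (x - y) < e.
Proof.
split=> [Ax e e0|Ax B].
  have : nbhs x (ball x e%:C) by apply: nbhsx_ballx; rewrite ltcR.
  move=> /Ax[y [Ay]]; rewrite -ball_normE /= rnormE ltcR => xy.
  by exists y.
rewrite -nbhs_ballE => -[e' /= /gt0_complexP[e e0 ->]] sB.
have [y Ay xy] := Ax _ e0; exists y; split=> //; apply: sB.
by rewrite -ball_normE /= rnormE ltcR.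
Qed.

End RealNorm.

(** The sets [A e] form a filter base, which the third hypothesis makes Cauchy, so completeness
    provides a limit. It yields limits of approximate solutions without choosing a sequence of
    them. *)
Lemma nested_limit (R : realType) (V : completeNormedModType R[i])
    (A : R -> set V) :
  (forall e, 0 < e -> A e !=set0) ->
  (forall e e', e <= e' -> A e `<=` A e') ->
  (forall d, 0 < d -> exists2 e, 0 < e &
    forall x y, A e x -> A e y -> rnorm (x - y) < d) ->
  exists z, forall e, 0 < e -> exists2 x, A e x & rnorm (z - x) < e.
Proof.
move=> A0 Amono Acauchy.
pose F : set_system V := filter_from [set e : R | 0 < e] A.
have FF : ProperFilter F.
  apply: filter_from_proper; last exact: A0.
  apply: filter_from_filter; first by exists 1 => /=.
  move=> e e' /= e0 e'0; exists (Num.min e e').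
    by rewrite /= lt_min e0.
  by move=> x Ax; split; apply: Amono Ax; rewrite ge_min lexx ?orbT.
have Fc : cauchy F.
  apply: cauchy_exP => _ /gt0_complexP[d d0 ->].
  have [e e0 Ae] := Acauchy _ d0; have [x Aex] := A0 _ e0.
  exists x, e => // y Aey; rewrite -ball_normE /= rnormE ltcR.
  exact: Ae.
have Fz := @cauchy_cvg V F FF Fc.
exists (lim F) => e e0.
have := Fz (ball (lim F) e%:C); case.
  by apply: nbhsx_ballx; rewrite ltcR.
move=> e' /= e'0 sA; have m0 : 0 < Num.min e e' by rewrite lt_min e0.
have [x Ax] := A0 _ m0; exists x.
  by apply: Amono Ax; rewrite ge_min lexx.
have : A e' x by apply: Amono Ax; rewrite ge_min lexx orbT.
by move=> /sA; rewrite -ball_normE /= rnormE ltcR.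
Qed.

(** * Sesquilinearity and the Cauchy-Schwarz inequality *)

Section InnerProduct.
Variables (R : realType) (H : hilbertType R).
Implicit Types x y z : H.

Lemma innerDr x y z : inner x (y + z) = inner x y + inner x z.
Proof. by rewrite -[y in LHS]scale1r innerPr mul1r. Qed.

Lemma inner0r x : inner x 0 = 0.
Proof. by apply: (addrI (inner x 0)); rewrite -innerDr !addr0. Qed.

Lemma innerZr a x y : inner x (a *: y) = a * inner x y.
Proof. by rewrite -[_ *: _]addr0 innerPr inner0r addr0. Qed.

Lemma innerNr x y : inner x (- y) = - inner x y.
Proof. by rewrite -scaleN1r innerZr mulN1r. Qed.

Lemma innerBr x y z : inner x (y - z) = inner x y - inner x z.
Proof. by rewrite innerDr innerNr. Qed.

Lemma innerC x y : inner x y = (inner y x)^*%R.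
Proof. exact: inner_conj. Qed.

Lemma innerDl x y z : inner (x + y) z = inner x z + inner y z.
Proof. by rewrite innerC innerDr rmorphD /= -!innerC. Qed.

Lemma inner0l x : inner 0 x = 0.
Proof. by rewrite innerC inner0r rmorph0. Qed.

Lemma innerZl a x y : inner (a *: x) y = a^*%R * inner x y.
Proof. by rewrite innerC innerZr rmorphM /= -innerC. Qed.

Lemma innerNl x y : inner (- x) y = - inner x y.
Proof. by rewrite innerC innerNr rmorphN /= -innerC. Qed.

Lemma innerBl x y z : inner (x - y) z = inner x z - inner y z.
Proof. by rewrite innerDl innerNl. Qed.

Lemma inner_sumr x n (f : 'I_n -> H) :
  inner x (\sum_i f i) = \sum_i inner x (f i).
Proof. exact: (big_morph _ (innerDr x) (inner0r x)). Qed.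

Lemma inner_suml y n (f : 'I_n -> H) :
  inner (\sum_i f i) y = \sum_i inner (f i) y.
Proof. exact: (big_morph _ (fun u v => innerDl u v y) (inner0l y)). Qed.

Lemma innerxx x : inner x x = (rnorm x ^+ 2)%:C.
Proof. by rewrite inner_norm rnormE rmorphXn. Qed.

Lemma inner_ext x y : (forall z, inner x z = inner y z) -> x = y.
Proof.
move=> xy; apply/eqP; rewrite -subr_eq0; apply/eqP/rnorm_eq0/eqP.
rewrite -sqrf_eq0; apply/eqP/complexI.
by rewrite -innerxx innerBl xy subrr.
Qed.

Lemma cauchy_schwarz x y : `|inner x y| <= `|x| * `|y|.
Proof.
have [->|y0] := eqVneq y 0; first by rewrite inner0r !normr0 mulr0.
have ny : 0 < `|y| by rewrite normr_gt0.
have yx : inner y x = (inner x y)^*%R by rewrite -innerC.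
rewrite -(@ler_pXn2r _ 2) ?nnegrE ?mulr_ge0 //.
(* The squared norm of this vector is $|y|^2(|x|^2|y|^2-|\langle x|y\rangle|^2)$; the factor $|y|^2$
   is then cancelled. *)
have := exprn_ge0 2 (normr_ge0 ((`|y| ^+ 2) *: x - inner y x *: y)).
rewrite -inner_norm innerBl !innerBr !innerZl !innerZr !inner_norm yx.
rewrite conjCK normCK !rmorphXn /= (CrealP (normr_real _)) => h.
have : 0 <= `|y| ^+ 2 * (`|x| ^+ 2 * `|y| ^+ 2 - inner x y * (inner x y)^*%R).
  by apply: le_trans h _; rewrite le_eqVlt; apply/orP; left; apply/eqP; ring.
by rewrite pmulr_rge0 ?exprn_gt0 // subr_ge0 exprMn.
Qed.

Lemma Re_inner_le x y : complex.Re (inner x y) <= rnorm x * rnorm y.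
Proof.
have := le_trans (normc_ge_Re _) (cauchy_schwarz x y).
by rewrite !rnormE -rmorphM lecR; apply: le_trans; rewrite ler_norm.
Qed.

Lemma cauchy_schwarz_real x y : rnorm (inner x y : R[i]^o) <= rnorm x * rnorm y.
Proof. by rewrite -lecR rmorphM /= -!rnormE cauchy_schwarz. Qed.

End InnerProduct.

(** * Elementary facts on bounded operators and their composition *)

Section Operators.
Variable R : realType.

Section Norm.
Variables H K : normedModType R[i].
Implicit Types S T : boundedOp H K.

Lemma op_ext T S : T =1 S -> T = S.
Proof. by move=> TS; apply/val_inj/funext. Qed.

Lemma opD T S x : (T + S) x = T x + S x. Proof. by []. Qed.

Lemma opZ a T x : (a *: T) x = a *: T x. Proof. by []. Qed.

Lemma op_bound T x : rnorm (T x) <= rnorm T * rnorm x.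
Proof. by rewrite -lecR rmorphM /= -!rnormE opnorm_bound. Qed.

Lemma op_le T (M : R) :
  0 <= M -> (forall x, rnorm (T x) <= M * rnorm x) -> rnorm T <= M.
Proof.
move=> M0 TM; apply: opnorm_le => // x.
by rewrite !rnormE -rmorphM lecR.
Qed.

Lemma bounded_op_exists (f : H -> K) (M : R) :
  linear f -> (forall x, rnorm (f x) <= M * rnorm x) ->
  exists T : boundedOp H K, T =1 f.
Proof.
move=> fl fM; have fb : f \in @bounded_linear R H K.
  by rewrite inE; split=> //; exists M => x; rewrite !rnormE -rmorphM lecR.
by exists (BoundedOp fb).
Qed.

End Norm.

Lemma bcompA (H K L M : normedModType R[i]) (S : boundedOp L M)
    (T : boundedOp K L) (U : boundedOp H K) :
  bcomp S (bcomp T U) = bcomp (bcomp S T) U.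
Proof. exact: op_ext. Qed.

Lemma bcomp_linearr (H K L : normedModType R[i]) (S : boundedOp K L) a
    (T U : boundedOp H K) :
  bcomp S (a *: T + U) = a *: bcomp S T + bcomp S U.
Proof. by apply: op_ext => x; exact: linearP. Qed.

Lemma bcomp_linearl (H K L : normedModType R[i]) (S : boundedOp H K) a
    (T U : boundedOp K L) :
  bcomp (a *: T + U) S = a *: bcomp T S + bcomp U S.
Proof. exact: op_ext. Qed.

Lemma bcomp_norm (H K L : normedModType R[i]) (S : boundedOp K L)
    (T : boundedOp H K) : rnorm (bcomp S T) <= rnorm S * rnorm T.
Proof.
apply: op_le => [|x]; first by rewrite mulr_ge0 ?rnorm_ge0.
apply: le_trans (op_bound S (T x)) _.
by rewrite -mulrA ler_wpM2l ?rnorm_ge0 ?op_bound.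
Qed.

End Operators.

(** * The Riesz representation theorem *)

Section Riesz.
Variables (R : realType) (H : hilbertType R).

Lemma rnorm_sqrD (x y : H) :
  rnorm (x + y) ^+ 2 = rnorm x ^+ 2 + rnorm y ^+ 2 + 2 * complex.Re (inner x y).
Proof.
apply: complexI; rewrite -innerxx innerDl !innerDr (innerC y x) !innerxx.
rewrite !rmorphD rmorphM /=.
by case: (inner x y) => a b /=; simpc; congr (_ +i* _); ring.
Qed.

Lemma quadratic_ge0_linear_coef0 (a b : R) :
  0 <= a -> (forall t, 0 <= t ^+ 2 * a + 2 * (t * b)) -> b = 0.
Proof.
(* The minimizer $-b/a$ is replaced by $-b/(a+1)$, which makes sense for $a=0$ and still gives a
   negative value unless $b=0$. *)
move=> a0 /(_ (- b / (a + 1))) h.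
have a1 : 0 < a + 1 by rewrite ltr_wpDl.
have E : (- b / (a + 1)) ^+ 2 * a + 2 * (- b / (a + 1) * b) =
    - (b ^+ 2 * (a + 2)) / (a + 1) ^+ 2.
  by field; rewrite gt_eqF.
move: h; rewrite E mulNr oppr_ge0 pmulr_lle0 ?invr_gt0 ?exprn_gt0 //.
rewrite pmulr_lle0 ?ltr_wpDl // => b2; apply/eqP; rewrite -sqrf_eq0.
by rewrite eq_le b2 sqr_ge0.
Qed.

(* The representing vector minimizes [|x|^2 - 2 Re (f x)]. *)
Lemma riesz (f : H -> R[i]^o) (M : R) :
  linear f -> (forall x, rnorm (f x) <= M * rnorm x) ->
  exists z, forall x, f x = inner z x.
Proof.
move=> fl fM.
have fD x y : f (x + y) = f x + f y.
  by rewrite -[x]scale1r fl !scale1r.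
have f0 : f 0 = 0 by apply: (addrI (f 0)); rewrite -fD !addr0.
have fZ a x : f (a *: x) = a * f x by rewrite -[_ *: _]addr0 fl f0 addr0.
pose rf x := complex.Re (f x).
have rfD x y : rf (x + y) = rf x + rf y by rewrite /rf fD raddfD.
have rfM x : `|rf x| <= `|M| * rnorm x.
  apply: (@le_trans _ _ (rnorm (f x))).
    by rewrite -lecR -rnormE normc_ge_Re.
  by apply: le_trans (fM x) _; rewrite ler_wpM2r ?rnorm_ge0 ?ler_norm.
pose J x := rnorm x ^+ 2 - 2 * rf x.
(* [J] is bounded below: $|x|^2-2|M||x|\ge-|M|^2$ because $(|x|-|M|)^2\ge0$. *)
have JM x : - `|M| ^+ 2 <= J x.
  have := rfM x; rewrite ler_norml => /andP[_ h].
  have := sqr_ge0 (rnorm x - `|M|); rewrite /J; nra.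
have hJ : has_inf (range J).
  split; first by exists (J 0), 0.
  by exists (- `|M| ^+ 2) => _ [x _ <-].
pose m := inf (range J).
have mJ x : m <= J x by apply: ge_inf; [case: hJ|exists x].
(* The parallelogram law; the linear parts of [J] cancel. Since [J] is at least [m] at the midpoint,
   almost minimizing vectors are close to each other. *)
have midJ x y : rnorm (x - y) ^+ 2 =
    2 * J x + 2 * J y - 4 * J (2^-1 *: (x + y)).
  have dbl v : rf (2 *: v) = 2 * rf v.
    by rewrite scaler_nat mulr2n rfD; ring.
  have h2 v : rnorm (2 *: v : H) ^+ 2 = 4 * rnorm v ^+ 2.
    by rewrite scaler_nat mulr2n rnorm_sqrD innerxx /=; ring.
  set u := 2^-1 *: _; have uE : x + y = 2 *: u.
    by rewrite scalerA divff ?scale1r.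
  have := dbl u; rewrite -uE rfD => e1.
  have := h2 u; rewrite -uE rnorm_sqrD => e2.
  by rewrite rnorm_sqrD rnormN innerNr raddfN /= /J; lra.
have [z zJ] : exists z, forall e, 0 < e ->
    exists2 x, J x < m + e & rnorm (z - x) < e.
  apply: (@nested_limit _ _ (fun e => [set x | J x < m + e])).
  - move=> e e0; have [_ [x _ <-] h] := inf_adherent e0 hJ.
    by exists x.
  - by move=> e e' ee' x /= h; apply: lt_le_trans h _; rewrite lerD2l.
  (* By [midJ], two vectors with [J] below $m+e$ satisfy $|x-y|^2<4e$. *)
  - move=> d d0; exists (d ^+ 2 / 4); first by rewrite divr_gt0 ?exprn_gt0.
    move=> x y /= hx hy; rewrite -(@ltr_pXn2r _ 2) ?nnegrE ?rnorm_ge0 ?ltW //.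
    rewrite midJ; have := mJ (2^-1 *: (x + y)); lra.
have Jz : J z <= m.
  (* For $|z-x|<e'\le1$ one has $J(z)-J(x)\le e'(2|z|+1+2|M|)$; the last summand 1 of [C] absorbs
     the excess $J(x)-m<e'$. *)
  pose C := 2 * rnorm z + 1 + 2 * `|M| + 1.
  have C0 : 0 < C by rewrite /C; have := rnorm_ge0 z; have := normr_ge0 M; lra.
  apply/ler_addgt0Pr => e e0.
  pose e' := Num.min 1 (e / C).
  have e'0 : 0 < e' by rewrite lt_min ltr01 divr_gt0.
  have e'C : e' * C <= e by rewrite -ler_pdivlMr // ge_min lexx orbT.
  have e'1 : e' <= 1 by rewrite ge_min lexx.
  have [x hx hzx] := zJ _ e'0.
  have -> : J z =
      J x + (rnorm z - rnorm x) * (rnorm z + rnorm x) - 2 * rf (z - x).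
    have : rf z = rf (z - x) + rf x by rewrite -rfD subrK.
    by rewrite /J => ->; ring.
  have h1 : rnorm z - rnorm x <= rnorm (z - x).
    by rewrite lerBlDr (le_trans _ (rnormD _ _)) // subrK.
  have h2 : rnorm x - rnorm z <= rnorm (z - x).
    by rewrite rnormBC lerBlDr (le_trans _ (rnormD _ _)) // subrK.
  have := rfM (z - x); rewrite ler_norml => /andP[h3 _].
  have := rnorm_ge0 z; have := rnorm_ge0 x; have := normr_ge0 M => M0 x0 z0.
  have h0 := rnorm_ge0 (z - x).
  have h4 : `|M| * rnorm (z - x) <= `|M| * e' by rewrite ler_wpM2l // ltW.
  have h5 : (rnorm z - rnorm x) * (rnorm z + rnorm x) <=
      e' * (2 * rnorm z + 1).
    apply: (@le_trans _ _ (rnorm (z - x) * (rnorm z + rnorm x))).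
      by rewrite ler_wpM2r ?addr_ge0.
    apply: ler_pM => //; rewrite ?addr_ge0 //; lra.
  by move: e'C; rewrite /C; lra.
exists z => h; apply/eqP; rewrite -subr_eq0; apply/eqP.
(* Minimality of [z] along the real line $z+tk$ makes the first-order coefficient in [t] vanish. *)
have key k : complex.Re (inner z k - f k) = 0.
  apply: (@quadratic_ge0_linear_coef0 (rnorm k ^+ 2)); first exact: sqr_ge0.
  move=> t; have := le_trans Jz (mJ (z + t%:C *: k)).
  rewrite /J rfD rnorm_sqrD innerZr /rf fZ.
  have -> : rnorm (t%:C *: k) ^+ 2 = t ^+ 2 * rnorm k ^+ 2.
    apply: complexI; rewrite -innerxx innerZl innerZr innerxx.
    rewrite (_ : (t%:C)^*%R = t%:C) ?rmorphM ?rmorphXn /=; first by ring.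
    by rewrite /Num.conj /= oppr0.
  move: (inner z k) (f k) => [a b] [c d] /=; rewrite !mul0r !subr0; lra.
(* This multiple of [h] turns the real part into the squared modulus of $\langle
   z|h\rangle-f(h)$. *)
have := key ((inner z h - f h)^*%R *: h).
rewrite innerZr fZ -mulrBr mulrC -normCK rnormE -rmorphXn /= => /eqP.
rewrite sqrf_eq0 => /eqP h0; apply/eqP; rewrite -normr_eq0.
by rewrite -opprB normrN rnormE h0.
Qed.

End Riesz.

(** * Existence and calculus of adjoints *)

Section Adjoint.
Variable R : realType.

(** Cauchy-Schwarz followed by division by $|x|$. With $x=T^*y$ it bounds the adjoint by the norm of
    [T]. *)
Lemma norm_le_dual (H K : hilbertType R) (T : boundedOp H K) (x : H) (y : K) :
  rnorm x ^+ 2 = complex.Re (inner y (T x)) -> rnorm x <= rnorm T * rnorm y.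
Proof.
have [->|x0] := eqVneq x 0; first by rewrite rnorm0 mulr_ge0 ?rnorm_ge0.
have n0 : 0 < rnorm x.
  by rewrite lt_def rnorm_ge0 andbT; apply: contra_neq x0 => /rnorm_eq0.
move=> xE; rewrite -(ler_pM2r n0) -expr2 xE.
apply: le_trans (Re_inner_le _ _) _.
by rewrite (mulrC (rnorm T)) -mulrA ler_wpM2l ?rnorm_ge0 // op_bound.
Qed.

Lemma adjointP (H K : hilbertType R) (T : boundedOp H K) x y :
  inner (T x) y = inner x (adjoint T y).
Proof.
(* In the default case of [xget] no adjoint exists; the operator built from the Riesz vectors of
   $x\mapsto\langle y|Tx\rangle$ refutes this. *)
rewrite /adjoint; case: xgetP => [S _ //|nS]; exfalso.
have /boolp.choice[g gP] :
    forall y, exists z, forall x, inner y (T x) = inner z x.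
  move=> {}y; apply: (@riesz _ _ (fun x => inner y (T x)) (rnorm y * rnorm T)).
    by move=> a u v; rewrite linearP innerPr.
  move=> {}x; apply: le_trans (cauchy_schwarz_real _ _) _.
  by rewrite -mulrA ler_wpM2l ?rnorm_ge0 ?op_bound.
have [S SE] : exists S : boundedOp K H, S =1 g.
  apply: (@bounded_op_exists _ _ _ _ (rnorm T)).
    move=> a u v; apply: inner_ext => w.
    by rewrite -gP !innerDl !innerZl -!gP.
  move=> v; apply: (@norm_le_dual _ _ T).
  by rewrite gP innerxx.
by apply: (nS S) => u v; rewrite innerC gP -innerC SE.
Qed.

Lemma adjointPl (H K : hilbertType R) (T : boundedOp H K) x y :
  inner (adjoint T y) x = inner y (T x).
Proof. by rewrite innerC -adjointP -innerC. Qed.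

Lemma adjoint_unique (H K : hilbertType R) (T : boundedOp H K)
    (S : boundedOp K H) :
  (forall x y, inner (T x) y = inner x (S y)) -> adjoint T = S.
Proof.
move=> TS; apply: op_ext => y; apply: inner_ext => x.
by rewrite adjointPl innerC TS -innerC.
Qed.

Lemma adjointK (H K : hilbertType R) (T : boundedOp H K) :
  adjoint (adjoint T) = T.
Proof. by apply: adjoint_unique => x y; rewrite adjointPl. Qed.

Lemma adjoint_comp (H K L : hilbertType R) (S : boundedOp K L)
    (T : boundedOp H K) :
  adjoint (bcomp S T) = bcomp (adjoint T) (adjoint S).
Proof. by apply: adjoint_unique => x y; rewrite /= !adjointP. Qed.

Lemma adjoint_semilinear (H K : hilbertType R) a (S T : boundedOp H K) :
  adjoint (a *: S + T) = a^*%R *: adjoint S + adjoint T.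
Proof.
apply: adjoint_unique => x y.
by rewrite !opD !opZ innerDl innerDr innerZl innerZr !adjointP.
Qed.

Lemma adjoint_norm (H K : hilbertType R) (T : boundedOp H K) :
  rnorm (adjoint T) <= rnorm T.
Proof.
apply: op_le (rnorm_ge0 _) _ => y; apply: (@norm_le_dual _ _ T).
by rewrite -adjointPl innerxx.
Qed.

End Adjoint.

(** * Subspaces and closed linear spans *)

Section Span.
Variable R : realType.
Implicit Types V W : normedModType R[i].

Lemma rnormZ V (a : R[i]) (x : V) : rnorm (a *: x) = rnorm (a : R[i]^o) * rnorm x.
Proof.
apply: complexI.
by rewrite rmorphM /= -rnormE normrZ [`|x|]rnormE [`|a|](@rnormE _ R[i]^o).
Qed.

Lemma rnorm_sum V n (f : 'I_n -> V) :
  rnorm (\sum_i f i) <= \sum_i rnorm (f i).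
Proof.
elim/big_ind2: _ => [|x a y b xa yb|//]; first by rewrite rnorm0.
by apply: le_trans (rnormD _ _) _; rewrite lerD.
Qed.

Lemma subspaceZ V (S : set V) a x : is_subspace S -> S x -> S (a *: x).
Proof. by move=> [S0 Sl] Sx; rewrite -[_ *: _]addr0; apply: Sl. Qed.

Lemma subspaceD V (S : set V) x y : is_subspace S -> S x -> S y -> S (x + y).
Proof. by move=> [S0 Sl] Sx Sy; rewrite -[x]scale1r; apply: Sl. Qed.

Lemma subspaceB V (S : set V) x y : is_subspace S -> S x -> S y -> S (x - y).
Proof. by move=> [S0 Sl] Sx Sy; rewrite addrC -scaleN1r; apply: Sl. Qed.

Lemma linear_span_subspace V (Y : set V) : is_subspace (linear_span Y).
Proof.
split=> [|a u v [n [f [y [Yy ->]]]] [m [g [z [Yz ->]]]]].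
  by exists 0, (fun=> 0), (fun=> 0); split=> [[]//|]; rewrite big_ord0.
exists (n + m)%N,
  (fun i : 'I_(n + m) =>
     match fintype.split i with inl j => a * f j | inr j => g j end),
  (fun i : 'I_(n + m) =>
     match fintype.split i with inl j => y j | inr j => z j end).
split=> [i|].
  by case: (fintype.split i).
rewrite big_split_ord /= scaler_sumr; congr (_ + _); apply: eq_bigr => i _.
  by rewrite -[lshift m i]/(unsplit (inl i)) unsplitK scalerA.
by rewrite -[rshift n i]/(unsplit (inr i)) unsplitK.
Qed.

Lemma subset_linear_span V (Y : set V) : Y `<=` linear_span Y.
Proof.
move=> y Yy; exists 1, (fun=> 1), (fun=> y); split=> //.
by rewrite big_ord1 scale1r.
Qed.

Lemma linear_span_min V (Y S : set V) :
  is_subspace S -> Y `<=` S -> linear_span Y `<=` S.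
Proof.
move=> Ss YS _ [n [a [y [Yy ->]]]].
elim/big_ind: _ => [|u v|i _]; first by case: Ss.
  exact: subspaceD.
by apply: subspaceZ => //; apply: YS.
Qed.

Lemma closure_subspace V (S : set V) : is_subspace S -> is_subspace (closure S).
Proof.
move=> Ss; split; first by apply: subset_closure; case: Ss.
move=> a u v /closureP Su /closureP Sv; apply/closureP => e e0.
(* The summand 1 keeps the divisor positive when $a=0$. *)
pose C := rnorm (a : R[i]^o) + 1.
have C0 : 0 < C by rewrite ltr_wpDl ?rnorm_ge0.
have [u' Su' uu'] := Su (e / 2 / C) (divr_gt0 (divr_gt0 e0 (ltr0Sn _ _)) C0).
have [v' Sv' vv'] := Sv (e / 2) (divr_gt0 e0 (ltr0Sn _ _)).
exists (a *: u' + v'); first by case: Ss => _; apply.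
rewrite opprD addrACA -scalerBr (le_lt_trans (rnormD _ _)) // rnormZ.
have : rnorm (a : R[i]^o) * rnorm (u - u') <= e / 2.
  apply: (@le_trans _ _ (C * rnorm (u - u'))).
    by rewrite ler_wpM2r ?rnorm_ge0 // lerDl.
  by rewrite mulrC -ler_pdivlMr // ltW.
by move: vv'; lra.
Qed.

Lemma closed_span_subspace V (Y : set V) : is_subspace (closed_span Y).
Proof. exact/closure_subspace/linear_span_subspace. Qed.

Lemma closed_span_closed V (Y : set V) : closed (closed_span Y).
Proof. exact: closed_closure. Qed.

Lemma subset_closed_span V (Y : set V) : Y `<=` closed_span Y.
Proof. by move=> y /subset_linear_span; apply: subset_closure. Qed.

Lemma closed_span_min V (Y S : set V) :
  closed S -> is_subspace S -> Y `<=` S -> closed_span Y `<=` S.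
Proof.
move=> Sc Ss YS; rewrite (_ : S = closure S); last exact/closure_id.
by apply: closureS; apply: linear_span_min.
Qed.

(** The vectors of [D] sent into [Q] form a closed subspace, so generators suffice. The domain [D]
    accommodates maps controlled only on a closed subspace, such as [rho] and [ket1]; the twist [s]
    is the identity or, for adjoints, complex conjugation. *)
Lemma closed_span_map V W (s : {rmorphism R[i] -> R[i]}) (D Y : set V)
    (Q : set W) (f : V -> W) (M : R) :
  closed D -> is_subspace D -> closed Q -> is_subspace Q -> 0 <= M ->
  (forall a x y, D x -> D y -> f (a *: x + y) = s a *: f x + f y) ->
  (forall x, D x -> rnorm (f x) <= M * rnorm x) ->
  Y `<=` D -> (forall y, Y y -> Q (f y)) ->
  forall x, closed_span Y x -> D x /\ Q (f x).
Proof.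
move=> Dc Ds Qc Qs M0 fl fM YD YQ.
have f0 : f 0 = 0.
  apply: rnorm_eq0; apply: le_anti; rewrite rnorm_ge0 andbT.
  by apply: le_trans (fM _ _) _; rewrite ?rnorm0 ?mulr0 //; case: Ds.
have DQs : is_subspace [set x | D x /\ Q (f x)].
  split=> [|a x y [Dx Qx] [Dy Qy]].
    by split; [case: Ds|rewrite f0; case: Qs].
  split; first by case: Ds => _; apply.
  by rewrite fl //; case: Qs => _; apply.
apply: closed_span_min => //; last by move=> y Yy; split; [apply: YD|apply: YQ].
move=> x /closureP cx; have Dx : D x.
  by apply: Dc; apply/closureP => e /cx[y [Dy _]]; exists y.
split=> //; apply: Qc; apply/closureP => e e0.
have M1 : 0 < M + 1 by rewrite ltr_wpDl.
have [y [Dy Qy] xy] := cx _ (divr_gt0 e0 M1).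
exists (f y) => //.
have -> : f x - f y = f (x - y).
  by rewrite addrC -scaleN1r -(rmorphN1 s) -fl // scaleN1r addrC.
apply: le_lt_trans (fM _ (subspaceB Ds Dx Dy)) _.
apply: le_lt_trans (_ : (M + 1) * rnorm (x - y) < e).
  by rewrite ler_wpM2r ?rnorm_ge0 // lerDl.
by rewrite mulrC -ltr_pdivlMr.
Qed.

Lemma closed_span_linear_map V W (Y : set V) (Q : set W) (f : V -> W) (M : R) :
  closed Q -> is_subspace Q -> 0 <= M -> linear f ->
  (forall x, rnorm (f x) <= M * rnorm x) ->
  (forall y, Y y -> Q (f y)) -> forall x, closed_span Y x -> Q (f x).
Proof.
move=> Qc Qs M0 fl fM YQ x Yx.
have DT : is_subspace [set: V] by [].
by have [] := @closed_span_map V W idfun _ Y Q f M closedT DT Qc Qs M0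
  (fun a u v _ _ => fl a u v) (fun u _ => fM u) (fun _ _ => I) YQ x Yx.
Qed.

End Span.

(** * Extension of densely defined bounded operators *)

Section Extension.
Variable R : realType.

Lemma rnorm_pair (V W : normedModType R[i]) (p : V * W) :
  rnorm p = Num.max (rnorm p.1) (rnorm p.2).
Proof.
apply: complexI; rewrite -rnormE prod_normE !rnormE.
by rewrite /Num.max /Order.max ltcR; case: ifP.
Qed.

(** The operator is given by its graph [G], so that no well-definedness is required beforehand: the
    bound implies it. The bound passes to the closure of [G], which completeness of [W] makes the
    graph of an everywhere defined map. *)
Lemma bounded_extension (V : normedModType R[i])
    (W : completeNormedModType R[i]) (G : set (V * W)) (M : R) :
  0 <= M -> is_subspace G ->
  (forall p, G p -> rnorm p.2 <= M * rnorm p.1) ->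
  closure (fst @` G) = setT ->
  exists2 T : boundedOp V W, forall p, G p -> T p.1 = p.2 & rnorm T <= M.
Proof.
move=> M0 Gs GM Gd.
have cGs := closure_subspace Gs.
have cGM p : closure G p -> rnorm p.2 <= M * rnorm p.1.
  move=> /closureP cp; apply/ler_addgt0Pr => e e0.
  have M1 : 0 < M + 1 by rewrite ltr_wpDl.
  have [q Gq pq] := cp _ (divr_gt0 e0 M1).
  have h1 : rnorm p.2 <= rnorm (p - q).2 + rnorm q.2.
    by rewrite -{1}[p.2](subrK q.2) rnormD.
  have h2 : rnorm q.1 <= rnorm (p - q).1 + rnorm p.1.
    by rewrite rnormBC -{1}[q.1](subrK p.1) rnormD.
  move: pq; rewrite rnorm_pair gt_max => /andP[].
  have := GM _ Gq; rewrite !ltr_pdivlMr //; nra.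
have /boolp.choice[T TP] : forall x, exists z, closure G (x, z).
  move=> x.
  (* The approximate values at [x] are the second coordinates of points of [G] lying over the
     [e]-ball around [x]. *)
  have [||d d0|z zP] := @nested_limit R W
    (fun e => [set y | exists2 x', G (x', y) & rnorm (x - x') < e]).
  - move=> e e0; have : closure (fst @` G) x by rewrite Gd.
    by move=> /closureP/(_ _ e0)[_ [[x' y] g <-] xx']; exists y, x'.
  - by move=> e e' ee' y [x' g h]; exists x' => //; apply: lt_le_trans ee'.
  - have M1 : 0 < M + 1 by rewrite ltr_wpDl.
    exists (d / 2 / (M + 1)); first by rewrite !divr_gt0.
    move=> y y' [x1 g1 h1] [x2 g2 h2].
    apply: le_lt_trans (GM _ (subspaceB Gs g1 g2)) _.
    have : rnorm (x1 - x2) <= rnorm (x - x1) + rnorm (x - x2).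
      by rewrite (rnormBC x) -{1}[x1](subrK x) -addrA rnormD.
    by move: h1 h2; rewrite !ltr_pdivlMr // /=; nra.
  exists z; apply/closureP => e e0; have [y [x' g xx'] zy] := zP _ e0.
  by exists (x', y); rewrite // rnorm_pair gt_max xx' zy.
have TM x : rnorm (T x) <= M * rnorm x by apply: (cGM (x, T x)).
(* Two points of the closed graph over the same vector differ by a point over 0, whose second
   coordinate the bound forces to be 0. *)
have Tu p : closure G p -> T p.1 = p.2.
  move=> Gp; apply/eqP; rewrite -subr_eq0; apply/eqP/rnorm_eq0/le_anti.
  rewrite rnorm_ge0 andbT; have := cGM _ (subspaceB cGs (TP p.1) Gp).
  by rewrite /= subrr rnorm0 mulr0.
have Tl : linear T.
  by move=> a u v; rewrite (Tu (a *: (u, T u) + (v, T v))) //; apply: cGs.2.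
have [S SE] := bounded_op_exists Tl TM; exists S => [p Gp|].
  by rewrite SE Tu //; apply: subset_closure.
by apply: op_le => // x; rewrite SE.
Qed.

End Extension.

(** * Total sets: uniqueness and construction of operators *)

Section Totality.
Variable R : realType.

Lemma closed_zero (V : normedModType R[i]) : closed [set 0 : V].
Proof.
move=> x /closureP cx; apply: rnorm_eq0; apply: le_anti.
rewrite rnorm_ge0 andbT; apply/ler_addgt0Pr => e /cx[_ ->].
by rewrite subr0 add0r => /ltW.
Qed.

Lemma zero_subspace (V : normedModType R[i]) : is_subspace [set 0 : V].
Proof. by split=> // a u v -> ->; rewrite scaler0 addr0. Qed.

Lemma linear_eq0_total (V W : normedModType R[i]) (Y : set V) (f : V -> W)
    (M : R) :
  0 <= M -> linear f -> (forall x, rnorm (f x) <= M * rnorm x) ->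
  closed_span Y = setT -> (forall y, Y y -> f y = 0) -> forall x, f x = 0.
Proof.
move=> M0 fl fM YT fY x.
have Yx : closed_span Y x by rewrite YT.
exact: (closed_span_linear_map (@closed_zero W) (@zero_subspace W)
  M0 fl fM fY Yx).
Qed.

Lemma op_ext_total (V W : normedModType R[i]) (Y : set V)
    (T S : boundedOp V W) :
  closed_span Y = setT -> (forall y, Y y -> T y = S y) -> T = S.
Proof.
move=> YT TS; apply: op_ext => x; apply/eqP; rewrite -subr_eq0; apply/eqP.
apply: (linear_eq0_total (f := T - S) (rnorm_ge0 (T - S)) _ _ YT) => [|z|y Yy].
- exact: linearP.
- exact: op_bound.
- by rewrite -[LHS]/(T y - S y) TS // subrr.
Qed.

Lemma inner_ext_total (H : hilbertType R) (Y : set H) (u v : H) :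
  closed_span Y = setT -> (forall y, Y y -> inner y u = inner y v) -> u = v.
Proof.
move=> YT uv; apply: inner_ext => z; apply/eqP; rewrite -subr_eq0 -innerBl.
apply/eqP; apply: (linear_eq0_total (W := R[i]^o) (f := inner (u - v))
  (rnorm_ge0 (u - v)) _ _ YT) => [a x y|x|y Yy].
- exact: innerPr.
- exact: cauchy_schwarz_real.
- by rewrite innerC innerBr uv // subrr rmorph0.
Qed.

(** The linear span of [P] is a densely defined graph; the bound on linear combinations also
    expresses that the prescribed values are compatible. *)
Lemma family_extension (V : normedModType R[i])
    (W : completeNormedModType R[i]) (P : set (V * W)) (M : R) :
  0 <= M -> closed_span (fst @` P) = setT ->
  (forall p, linear_span P p -> rnorm p.2 <= M * rnorm p.1) ->
  exists2 T : boundedOp V W, forall p, P p -> T p.1 = p.2 & rnorm T <= M.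
Proof.
move=> M0 PT PM; have Ps := linear_span_subspace P.
have [|T TP TM] := bounded_extension M0 Ps PM.
  apply/seteqP; split=> // x _.
  have : closed_span (fst @` P) x by rewrite PT.
  apply: closureS; apply: linear_span_min.
    split; first by exists 0 => //; case: Ps.
    move=> a _ _ [p Pp <-] [q Pq <-]; exists (a *: p + q) => //.
    exact: Ps.2.
  by move=> _ [p Pp <-]; exists p => //; apply: subset_linear_span.
by exists T => // p Pp; apply: TP; apply: subset_linear_span.
Qed.

(** For a linear combination $(v,w)$ of the pairs, $|w|^2=\langle v|Av\rangle\le|A||v|^2\le
    M^2|v|^2$, which is the bound that [family_extension] asks for. *)
Lemma gram_extension (V W : hilbertType R) (P : set (V * W))
    (A : boundedOp V V) (M : R) :
  0 <= M -> rnorm A <= M ^+ 2 -> closed_span (fst @` P) = setT ->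
  (forall p q, P p -> P q -> inner p.2 q.2 = inner p.1 (A q.1)) ->
  exists2 T : boundedOp V W, forall p, P p -> T p.1 = p.2 & rnorm T <= M.
Proof.
move=> M0 AM PT PA; apply: family_extension => // p Pp.
(* The Gram identity is extended from [P] to its span one argument at a time: first the second
   argument, then the first. *)
have spanA q r : linear_span P q -> linear_span P r ->
    inner q.2 r.2 = inner q.1 (A r.1).
  move=> Pq Pr; pose Sr : set (V * W) := [set s | forall q, P q ->
    inner q.2 s.2 = inner q.1 (A s.1)].
  have Srr q' : P q' -> inner q'.2 r.2 = inner q'.1 (A r.1).
    move: q'; apply: (linear_span_min (S := Sr)) Pr.
      split=> [q' _|a s t hs ht q' Pq'] /=; first by rewrite linear0 !inner0r.
      by rewrite innerPr linearP innerPr hs // ht.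
    by move=> s Ps q' Pq'; apply: PA.
  apply: (linear_span_min (S := [set q | inner q.2 r.2 = inner q.1 (A r.1)])) Pq.
    split=> [|a s t hs ht] /=; first by rewrite !inner0l.
    by rewrite !innerDl !innerZl hs ht.
  exact: Srr.
rewrite -(@ler_pXn2r _ 2) ?nnegrE ?mulr_ge0 ?rnorm_ge0 //.
have -> : rnorm p.2 ^+ 2 = complex.Re (inner p.2 p.2) by rewrite innerxx.
rewrite spanA // exprMn; apply: le_trans (Re_inner_le _ _) _.
rewrite mulrC expr2 mulrA ler_wpM2r ?rnorm_ge0 //.
by apply: le_trans (op_bound _ _) _; rewrite ler_wpM2r ?rnorm_ge0.
Qed.

End Totality.

(* Squaring [a k / (s t^(2^k))] moves it to index [k+1]; a bounded sequence can
   grow in this way only if it never exceeds 1. *)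
Lemma squaring_bound (R : realType) (a : nat -> R) (s t C : R) :
  0 <= s -> 0 <= t -> (forall k, 0 <= a k) ->
  (forall k, a k ^+ 2 <= s * a k.+1) -> (forall k, a k <= C * t ^+ (2 ^ k)) ->
  a 0 <= t * s.
Proof.
move=> s0 t0 a0 aS aC.
have [se|sn] := eqVneq s 0.
  have := aS 0; rewrite se mul0r mulr0 => h.
  by rewrite (_ : a 0 = 0) //; apply/eqP; rewrite -sqrf_eq0 eq_le h sqr_ge0.
have [te|tn] := eqVneq t 0.
  by have := aC 0; rewrite te expn0 expr1 mulr0 mul0r.
have sp : 0 < s by rewrite lt_def sn.
have tp : 0 < t by rewrite lt_def tn.
have tX k : 0 < s * t ^+ (2 ^ k) by rewrite mulr_gt0 ?exprn_gt0.
pose b k := a k / (s * t ^+ (2 ^ k)).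
have bS k : b k ^+ 2 <= b k.+1.
  rewrite /b expnSr exprM.
  have -> : a k.+1 / (s * (t ^+ (2 ^ k)) ^+ 2) =
      s * a k.+1 / (s * t ^+ (2 ^ k)) ^+ 2.
    by field; rewrite sn expf_neq0.
  by rewrite expr_div_n ler_wpM2r // invr_ge0 exprn_ge0 // ltW.
have bC k : b k <= C / s.
  by rewrite /b ler_pdivrMr // mulrA divfK.
rewrite leNgt; apply/negP => lt0.
have b0 : 1 < b 0 by rewrite /b ltr_pdivlMr // mul1r expn0 expr1 mulrC.
(* With $e=b_0-1>0$ this says $b_k\ge1+(k+1)e$: squaring adds at least $e$. Linear growth already
   contradicts the bound $C/s$. *)
have grow k : 1 + k%:R * (b 0 - 1) + (b 0 - 1) <= b k.
  elim: k => [|k IH]; first by lra.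
  apply: le_trans (bS k); rewrite -natr1.
  have : 0 <= k%:R * (b 0 - 1) by rewrite mulr_ge0 // subr_ge0 ltW.
  by nra.
have e0 : 0 < b 0 - 1 by rewrite subr_gt0.
have := archi_boundP (_ : 0 <= `|C / s| / (b 0 - 1)).
rewrite divr_ge0 ?normr_ge0 ?(ltW e0) // => /(_ isT); rewrite ltr_pdivrMr //.
set k := Num.bound _ => kC.
by have := grow k; have := bC k; have := ler_norm (C / s); lra.
Qed.

(** * The representation [rho] of the commutant *)

Section Rho.
Variables (R : realType) (b : CstarBase R) (H : hilbertType R).
Variable beta : set (boundedOp b H).

Lemma base_alg_adjoint x : base_alg b x -> base_alg b (adjoint x).
Proof. by move=> bx; have [_ _ _ h _] := base_algP b; apply: h; exists x. Qed.

Lemma commutant_adjoint x :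
  commutant (base_alg b) x -> commutant (base_alg b) (adjoint x).
Proof.
move=> cx y By; rewrite -[y]adjointK -!adjoint_comp cx //.
exact: base_alg_adjoint.
Qed.

Lemma commutant_comp (X : set (boundedOp b b)) x y :
  commutant X x -> commutant X y -> commutant X (bcomp x y).
Proof. by move=> cx cy z Xz; rewrite -bcompA cy // bcompA cx // bcompA. Qed.

Hypothesis hbeta : is_Cstar_module b beta.

Lemma module_total : closed_span (opapply beta) = setT.
Proof. by case: hbeta. Qed.

Lemma module_adjoint_comp xi xi' :
  beta xi -> beta xi' -> base_alg b (bcomp (adjoint xi) xi').
Proof.
move=> bxi bxi'; have [_ _ _ _ <-] := hbeta.
by apply: subset_closed_span; exists (adjoint xi); [exists xi|exists xi'].
Qed.

Lemma module_op_ext (K : normedModType R[i]) (T S : boundedOp H K) :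
  (forall xi, beta xi -> bcomp T xi = bcomp S xi) -> T = S.
Proof.
move=> TS; apply: op_ext_total module_total _ => _ [xi bxi [z _ <-]].
by have := congr1 (fun U : boundedOp b K => U z) (TS _ bxi).
Qed.

(* With [S y = \sum_i a_i xi_i (y zeta_i)], commutation gives
   [|S y|^2 <= |S 1| |S (y^* y)|]; iterating this bounds [|S x|] by [|x| |S 1|]
   without square roots of operators. *)
Lemma rho_exists x : commutant (base_alg b) x ->
  exists2 T : boundedOp H H,
    forall xi, beta xi -> bcomp T xi = bcomp xi x & rnorm T <= rnorm x.
Proof.
move=> cx.
pose P : set (H * H) :=
  [set p | exists xi z, beta xi /\ p = (xi z, xi (x z))].
have PT : closed_span (fst @` P) = setT.
  rewrite -module_total; congr closed_span; apply/seteqP; split.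
    by move=> _ [_ [xi [z [bxi ->]]] <-]; exists xi => //; exists z.
  by move=> _ [xi bxi [z _ <-]]; exists (xi z, xi (x z)) => //; exists xi, z.
have [p [n [a [y [/boolp.choice[xi hxi] ->]]]]|T TP TM] :=
    family_extension (rnorm_ge0 x) PT.
  have /boolp.choice[z hz] := hxi.
  pose S (u : boundedOp b b) := \sum_i a i *: xi i (u (z i)).
  pose s := \sum_i a i *: xi i (z i).
  have sE : (\sum_i a i *: y i).1 = s.
    rewrite (big_morph fst (id1 := 0) (op1 := +%R)) //.
    by apply: eq_bigr => i _; have [_ ->] := hz i.
  have SE : (\sum_i a i *: y i).2 = S x.
    rewrite (big_morph snd (id1 := 0) (op1 := +%R)) //.
    by apply: eq_bigr => i _; have [_ ->] := hz i.
  (* The iterates of $y\mapsto y^*y$ from [x]: they stay in the commutant, and their norms are at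
     most $|x|^{2^k}$. *)
  pose pw := fix pw k :=
    if k is k'.+1 then bcomp (adjoint (pw k')) (pw k') else x.
  have pwc k : commutant (base_alg b) (pw k).
    elim: k => // k IH; apply: commutant_comp => //.
    exact: commutant_adjoint.
  have pwn k : rnorm (pw k) <= rnorm x ^+ (2 ^ k).
    elim: k => [|k IH]; first by rewrite expn0 expr1.
    rewrite expnSr exprM; apply: le_trans (bcomp_norm _ _) _.
    apply: (@le_trans _ _ (rnorm (pw k) ^+ 2)).
      by rewrite expr2 ler_wpM2r ?rnorm_ge0 ?adjoint_norm.
    by rewrite ler_pXn2r ?nnegrE ?exprn_ge0 ?rnorm_ge0.
  rewrite sE SE.
  (* Here $|s|$ is the norm of $S(1)$, and the constant is the triangle inequality bound
     $|S(u)|\le\sum_i|a_i||\xi_i||\zeta_i|\,|u|$. *)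
  apply: (@squaring_bound R (fun k => rnorm (S (pw k))) (rnorm s) (rnorm x)
    (\sum_i rnorm (a i : R[i]^o) * (rnorm (xi i) * rnorm (z i)))).
  - exact: rnorm_ge0.
  - exact: rnorm_ge0.
  - by move=> k; apply: rnorm_ge0.
  - move=> k; have bxi i : beta (xi i) by have [] := hz i.
    (* Termwise, $y^*$ moves past $\xi_i^*\xi_j$, which lies in the algebra of the base:
       $\langle\xi_iy\zeta_i|\xi_jy\zeta_j\rangle=\langle\xi_i\zeta_i|\xi_jy^*y\zeta_j\rangle$. *)
    have SS : inner (S (pw k)) (S (pw k)) = inner s (S (pw k.+1)).
      rewrite !inner_suml; apply: eq_bigr => i _.
      rewrite !inner_sumr; apply: eq_bigr => j _.
      rewrite !innerZl !innerZr; congr (_ * (_ * _)).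
      rewrite !adjointP.
      have := commutant_adjoint (pwc k) (module_adjoint_comp (bxi i) (bxi j)).
      move=> /(congr1 (fun U : boundedOp b b => U (pw k (z j)))) /= <-.
      by rewrite -adjointP.
    by have := Re_inner_le s (S (pw k.+1)); rewrite -SS innerxx.
  - move=> k; apply: le_trans (rnorm_sum _) _.
    rewrite mulr_suml; apply: ler_sum => i _.
    rewrite rnormZ -mulrA ler_wpM2l ?rnorm_ge0 //.
    apply: le_trans (op_bound _ _) _; rewrite -mulrA ler_wpM2l ?rnorm_ge0 //.
    apply: le_trans (op_bound _ _) _; rewrite mulrC.
    by rewrite ler_wpM2l ?rnorm_ge0.
exists T => // xi bxi; apply: op_ext => z.
by apply: (TP (xi z, xi (x z))); exists xi, z.
Qed.

Lemma rho_unique x T :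
  (forall xi, beta xi -> bcomp T xi = bcomp xi x) -> rho beta x = T.
Proof.
move=> Tx; apply: xget_unique => // S Sx.
by apply: module_op_ext => xi bxi; rewrite Tx // Sx.
Qed.

Lemma rhoP x xi : commutant (base_alg b) x -> beta xi ->
  bcomp (rho beta x) xi = bcomp xi x.
Proof.
by move=> /rho_exists[T Tx _]; move: xi; rewrite (rho_unique Tx).
Qed.

Lemma rho_norm x : commutant (base_alg b) x -> rnorm (rho beta x) <= rnorm x.
Proof. by move=> /rho_exists[T Tx TM]; rewrite (rho_unique Tx). Qed.

Lemma rho_linear a x y : commutant (base_alg b) x -> commutant (base_alg b) y ->
  rho beta (a *: x + y) = a *: rho beta x + rho beta y.
Proof.
move=> cx cy; apply: rho_unique => xi bxi.
by rewrite bcomp_linearl bcomp_linearr !rhoP.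
Qed.

End Rho.

(** * Membership of products with closed spans, tested on generators *)

Section SpanComposition.
Variable R : realType.
Implicit Types H K L : hilbertType R.

Lemma bcompr_span H K L (S : boundedOp K L) (Y : set (boundedOp H K))
    (Q : set (boundedOp H L)) :
  closed Q -> is_subspace Q -> (forall y, Y y -> Q (bcomp S y)) ->
  forall T, closed_span Y T -> Q (bcomp S T).
Proof.
move=> Qc Qs; apply: (closed_span_linear_map Qc Qs (rnorm_ge0 S)) => [a x y|x].
  exact: bcomp_linearr.
exact: bcomp_norm.
Qed.

Lemma bcompl_span H K L (T : boundedOp H K) (Y : set (boundedOp K L))
    (Q : set (boundedOp H L)) :
  closed Q -> is_subspace Q -> (forall y, Y y -> Q (bcomp y T)) ->
  forall S, closed_span Y S -> Q (bcomp S T).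
Proof.
move=> Qc Qs; apply: (closed_span_linear_map Qc Qs (rnorm_ge0 T)) => [a x y|x].
  exact: bcomp_linearl.
by rewrite mulrC bcomp_norm.
Qed.

Lemma adjoint_comp_span H K L (T : boundedOp H L) (Y : set (boundedOp K L))
    (Q : set (boundedOp H K)) :
  closed Q -> is_subspace Q -> (forall y, Y y -> Q (bcomp (adjoint y) T)) ->
  forall S, closed_span Y S -> Q (bcomp (adjoint S) T).
Proof.
move=> Qc Qs YQ S YS.
have DT : is_subspace [set: boundedOp K L] by [].
apply: (proj2 (closed_span_map (s := Num.conj) (Q := Q)
  (f := fun S => bcomp (adjoint S) T) closedT DT Qc Qs (rnorm_ge0 T)
  _ _ _ YQ YS)) => //.
- by move=> a x y _ _; rewrite adjoint_semilinear bcomp_linearl.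
- move=> x _; apply: le_trans (bcomp_norm _ _) _.
  by rewrite mulrC ler_wpM2l ?rnorm_ge0 ?adjoint_norm.
Qed.

End SpanComposition.

(** * The operators [ket2] on the relative tensor product *)

Section Tensor.
Variables (R : realType) (b : CstarBase R) (H K : hilbertType R).
Variables (beta : set (boundedOp b H)) (gamma : set (boundedOp b K)).
Hypothesis hbeta : is_Cstar_module b beta.
Hypothesis hgamma : is_Cstar_module (opposite b) gamma.
Variable HK : relTensor beta gamma.

Lemma base_opp_commutant y : base_opp_alg b y -> commutant (base_alg b) y.
Proof. by move=> hy S hS; rewrite (base_commute hS hy). Qed.

Lemma gamma_adjoint_comp eta eta' : gamma eta -> gamma eta' ->
  base_opp_alg b (bcomp (adjoint eta) eta').
Proof. exact: (module_adjoint_comp hgamma). Qed.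

Lemma ket2_exists eta : gamma eta ->
  exists2 T : boundedOp H HK,
    forall xi z, beta xi -> T (xi z) = tens HK xi z eta & rnorm T <= rnorm eta.
Proof.
move=> geta; have cee := base_opp_commutant (gamma_adjoint_comp geta geta).
pose P : set (H * HK) :=
  [set p | exists xi z, beta xi /\ p = (xi z, tens HK xi z eta)].
(* The twisting operator is $\rho_\beta(\eta^*\eta)$, of norm at most $|\eta|^2$, whence the bound
   $|\eta|$ for [T]. *)
have [|||T TP TM] := @gram_extension R H HK P
    (rho beta (bcomp (adjoint eta) eta)) (rnorm eta) (rnorm_ge0 eta).
- apply: le_trans (rho_norm hbeta cee) _; apply: le_trans (bcomp_norm _ _) _.
  by rewrite expr2 ler_wpM2r ?rnorm_ge0 ?adjoint_norm.
- rewrite -(module_total hbeta); congr closed_span; apply/seteqP; split.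
    by move=> _ [_ [xi [z [bxi ->]]] <-]; exists xi => //; exists z.
  move=> _ [xi bxi [z _ <-]]; exists (xi z, tens HK xi z eta) => //.
  by exists xi, z.
- move=> _ _ [xi [z [bxi ->]]] [xi' [z' [bxi' ->]]] /=.
  rewrite inner_tens // -adjointP; congr inner.
  by have /(congr1 (fun U : boundedOp b H => U z')) := rhoP hbeta cee bxi'.
exists T => // xi z bxi.
by apply: (TP (xi z, tens HK xi z eta)); exists xi, z.
Qed.

Lemma ket2_unique eta (T : boundedOp H HK) :
  (forall xi z, beta xi -> T (xi z) = tens HK xi z eta) -> ket2 HK eta = T.
Proof.
move=> hT; apply: xget_unique => // S hS.
apply: op_ext_total (module_total hbeta) _ => _ [xi bxi [z _ <-]].
by rewrite hT // hS.
Qed.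

Lemma ket2P eta xi z : gamma eta -> beta xi ->
  ket2 HK eta (xi z) = tens HK xi z eta.
Proof. by move=> /ket2_exists[T TP _] bxi; rewrite (ket2_unique TP) TP. Qed.

Lemma ket2_norm eta : gamma eta -> rnorm (ket2 HK eta) <= rnorm eta.
Proof. by move=> /ket2_exists[T TP TM]; rewrite (ket2_unique TP). Qed.

Lemma ket2_linear a eta eta' : gamma eta -> gamma eta' ->
  ket2 HK (a *: eta + eta') = a *: ket2 HK eta + ket2 HK eta'.
Proof.
move=> geta geta'; apply: ket2_unique => xi z bxi.
by rewrite opD opZ !ket2P // tens_linear3.
Qed.

Lemma ket2_total (U V : boundedOp HK HK) :
  (forall eta, gamma eta -> bcomp U (ket2 HK eta) = bcomp V (ket2 HK eta)) ->
  U = V.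
Proof.
move=> UV; apply: op_ext_total (tens_total HK) _.
move=> _ [xi [z [eta [bxi geta ->]]]].
rewrite -ket2P //.
by have /(congr1 (fun T : boundedOp H HK => T (xi z))) := UV _ geta.
Qed.

(** Tested on total vectors: in the defining form $\langle\zeta|\xi^*\xi'\eta^*\eta'\zeta'\rangle$,
    moving $\xi$ back to the left leaves
    $\xi'\eta^*\eta'\zeta'=\rho_\beta(\eta^*\eta')\xi'\zeta'$. *)
Lemma ket2_gram eta eta' : gamma eta -> gamma eta' ->
  bcomp (adjoint (ket2 HK eta)) (ket2 HK eta') =
  rho beta (bcomp (adjoint eta) eta').
Proof.
move=> geta geta'; have cee := base_opp_commutant (gamma_adjoint_comp geta geta').
apply: op_ext_total (module_total hbeta) _ => _ [xi' bxi' [z' _ <-]].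
apply: inner_ext_total (module_total hbeta) _ => _ [xi bxi [z _ <-]].
rewrite -adjointP !ket2P // inner_tens // -adjointP; congr inner.
by have /(congr1 (fun U : boundedOp b H => U z')) := rhoP hbeta cee bxi'.
Qed.

(** * Module structure of [ltensor] over an arbitrary base [a] *)

Section LeftModule.
Variables (a : CstarBase R) (alpha : set (boundedOp a H)).
Hypothesis halpha : is_Cstar_module a alpha.
Hypothesis rho_alpha :
  closed_span (opmul (rho beta @` base_opp_alg b) alpha) = alpha.

Lemma ltensor_ket2 eta al : gamma eta -> alpha al ->
  ltensor HK alpha (bcomp (ket2 HK eta) al).
Proof.
move=> geta aal; apply: subset_closed_span; exists (ket2 HK eta).
  by exists eta.
by exists al.
Qed.

Lemma rho_mem_alpha y al : base_opp_alg b y -> alpha al ->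
  alpha (bcomp (rho beta y) al).
Proof.
move=> hy aal; rewrite -rho_alpha; apply: subset_closed_span.
by exists (rho beta y); [exists y|exists al].
Qed.

(** An elementary tensor is $|\eta\rangle_2(\xi\zeta)$, and $\xi\zeta$ is a limit of combinations of
    vectors in the ranges of [alpha]. *)
Lemma ltensor_total : closed_span (opapply (ltensor HK alpha)) = setT.
Proof.
apply/seteqP; split=> // w _.
have : closed_span [set w | exists xi zeta eta,
  [/\ beta xi, gamma eta & w = tens HK xi zeta eta]] w by rewrite tens_total.
apply: closed_span_min => [||_ [xi [z [eta [bxi geta ->]]]]].
- exact: closed_span_closed.
- exact: closed_span_subspace.
rewrite -ket2P //.
have : closed_span (opapply alpha) (xi z) by rewrite (module_total halpha).
apply: (closed_span_linear_map _ _ (rnorm_ge0 (ket2 HK eta))) => [||c u v|u|].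
- exact: closed_span_closed.
- exact: closed_span_subspace.
- exact: linearP.
- exact: op_bound.
move=> _ [al aal [h _ <-]]; apply: subset_closed_span.
by exists (bcomp (ket2 HK eta) al); [apply: ltensor_ket2|exists h].
Qed.

Lemma ltensor_mul_alg :
  closed_span (opmul (ltensor HK alpha) (base_alg a)) = ltensor HK alpha.
Proof.
have [_ _ _ aA _] := halpha.
have lc := @closed_span_closed R _ (opmul (ket2 HK @` gamma) alpha).
have ls := @closed_span_subspace R _ (opmul (ket2 HK @` gamma) alpha).
apply/seteqP; split; apply: closed_span_min => //.
- move=> _ [T hT [x hx <-]]; move: T hT.
  apply: bcompl_span => // _ [_ [eta geta <-] [al aal <-]].
  rewrite -bcompA; apply: ltensor_ket2 => //; rewrite -aA.
  by apply: subset_closed_span; exists al => //; exists x.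
- exact: closed_span_closed.
- exact: closed_span_subspace.
- move=> _ [_ [eta geta <-] [al aal <-]].
  move: aal; rewrite -{1}aA; apply: bcompr_span => [||_ [al' aal' [x hx <-]]].
  + exact: closed_span_closed.
  + exact: closed_span_subspace.
  rewrite bcompA; apply: subset_closed_span.
  by exists (bcomp (ket2 HK eta) al'); [apply: ltensor_ket2|exists x].
Qed.

(** By [ket2_gram], generators multiply to $x^*\rho_\beta(\eta^*\eta')x'$ with $x,x'\in\alpha$, and
    $\rho_\beta(\eta^*\eta')x'$ lies in $\alpha$. For the converse, [alpha] is resolved as
    $[\rho_\beta(\mathfrak B^\dagger)\alpha]$ and $\mathfrak B^\dagger$ as $[\gamma^*\gamma]$. *)
Lemma ltensor_gram :
  closed_span (opmul (adjoints (ltensor HK alpha)) (ltensor HK alpha)) =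
  base_alg a.
Proof.
have [_ _ _ _ aa] := halpha.
have [As Ac _ _ _] := base_algP a.
have [_ _ _ _ gg] := hgamma.
have [Bs Bc _ _ _] := base_opp_algP b.
apply/seteqP; split; first apply: closed_span_min => //.
  move=> _ [_ [S hS <-] [T hT <-]].
  move: S hS; apply: adjoint_comp_span => // _ [_ [eta geta <-] [al aal <-]].
  move: T hT; apply: bcompr_span => // _ [_ [eta' geta' <-] [al' aal' <-]].
  rewrite adjoint_comp -bcompA (bcompA (adjoint (ket2 HK eta))) ket2_gram //.
  apply: (module_adjoint_comp halpha) => //; apply: rho_mem_alpha => //.
  exact: gamma_adjoint_comp.
set Q := closed_span _.
have Qc : closed Q by exact: closed_span_closed.
have Qs : is_subspace Q by exact: closed_span_subspace.
rewrite -aa; apply: closed_span_min => // _ [_ [al aal <-] [al' aal' <-]].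
move: al' aal'; rewrite -{1}rho_alpha.
apply: bcompr_span => // _ [_ [y hy <-] [al' aal' <-]].
have yspan : closed_span (opmul (adjoints gamma) gamma) y by rewrite gg.
have C0 : 0 <= rnorm (adjoint al) * rnorm al' by rewrite mulr_ge0 ?rnorm_ge0.
(* The domain is $\mathfrak B^\dagger$, since linearity and the norm bound of [rho] are available on
   the commutant of $\mathfrak B$. *)
apply: (proj2 (closed_span_map (s := idfun) (D := base_opp_alg b) (Q := Q)
  (f := fun y => bcomp (adjoint al) (bcomp (rho beta y) al'))
  Bc Bs Qc Qs C0 _ _ _ _ yspan)).
- move=> c u v /base_opp_commutant cu /base_opp_commutant cv.
  by rewrite (rho_linear hbeta) // bcomp_linearl bcomp_linearr.
- move=> u /base_opp_commutant cu; apply: le_trans (bcomp_norm _ _) _.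
  rewrite -mulrA ler_wpM2l ?rnorm_ge0 // mulrC.
  apply: le_trans (bcomp_norm _ _) _.
  by rewrite ler_wpM2r ?rnorm_ge0 ?(rho_norm hbeta).
- by move=> _ [_ [eta geta <-] [eta' geta' <-]]; apply: gamma_adjoint_comp.
move=> _ [_ [eta geta <-] [eta' geta' <-]]; apply: subset_closed_span.
rewrite -ket2_gram // -bcompA bcompA -adjoint_comp.
exists (adjoint (bcomp (ket2 HK eta) al)).
  by exists (bcomp (ket2 HK eta) al) => //; apply: ltensor_ket2.
by exists (bcomp (ket2 HK eta') al') => //; apply: ltensor_ket2.
Qed.

Lemma ltensor_module : is_Cstar_module a (ltensor HK alpha).
Proof.
split.
- exact: closed_span_subspace.
- exact: closed_span_closed.
- exact: ltensor_total.
- exact: ltensor_mul_alg.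
- exact: ltensor_gram.
Qed.

(** Applied to $v\in\alpha$, both sides equal $|\eta\rangle_2vx$, because $|\eta\rangle_2v$ belongs
    to [ltensor]. *)
Lemma rho_ltensor_ket2 x eta : commutant (base_alg a) x -> gamma eta ->
  bcomp (rho (ltensor HK alpha) x) (ket2 HK eta) =
  bcomp (ket2 HK eta) (rho alpha x).
Proof.
move=> cx geta; apply: (module_op_ext halpha) => al aal.
rewrite -!bcompA (rhoP halpha) // (rhoP ltensor_module) ?bcompA //.
exact: ltensor_ket2.
Qed.

Lemma rho_ltensor x : commutant (base_alg a) x ->
  rho (ltensor HK alpha) x = op_tens_id HK (rho alpha x).
Proof.
move=> cx; apply/esym/xget_unique.
  split; last by move=> eta geta; apply: rho_ltensor_ket2.
  (* The commutant condition in [op_tens_id]: as $\rho_\beta(y)v\in\alpha$ for $v\in\alpha$, both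
     products send [v] to $\rho_\beta(y)vx$. *)
  move=> _ [y hy <-]; apply: (module_op_ext halpha) => al aal.
  by rewrite -!bcompA !(rhoP halpha) ?bcompA //; apply: rho_mem_alpha.
by move=> U [_ hU]; apply: ket2_total => eta geta; rewrite rho_ltensor_ket2 ?hU.
Qed.

Lemma rho_ltensor_tens x xi z eta : commutant (base_alg a) x ->
  beta xi -> gamma eta -> beta (bcomp (rho alpha x) xi) ->
  rho (ltensor HK alpha) x (tens HK xi z eta) =
  tens HK (bcomp (rho alpha x) xi) z eta.
Proof.
move=> cx bxi geta bxxi; rewrite -!ket2P //.
by have /(congr1 (fun T : boundedOp H HK => T (xi z))) :=
  rho_ltensor_ket2 cx geta.
Qed.

End LeftModule.

End Tensor.

(** * Symmetry of the relative tensor product *)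

Section Flip.
Variables (R : realType) (b : CstarBase R) (H K : hilbertType R).
Variables (beta : set (boundedOp b H)) (gamma : set (boundedOp b K)).
Hypothesis hbeta : is_Cstar_module b beta.
Hypothesis hgamma : is_Cstar_module (opposite b) gamma.
Variable HK : relTensor beta gamma.

(** The form is symmetric because $\xi^*\xi'\in\mathfrak B$ commutes with $\eta^*\eta'\in\mathfrak
    B^\dagger$. The definition is transparent, so that [ket2] of the flipped tensor product is
    convertible with [ket1] of [HK], and [ltensor] with [rtensor]. *)
Definition flip_tensor : @relTensor R (opposite b) K H gamma beta.
Proof.
apply: (@MkRelTensor R (opposite b) K H gamma beta HK
  (fun eta z xi => tens HK xi z eta)).
- by move=> *; apply: tens_linear3.
- by move=> *; apply: tens_linear2.
- by move=> *; apply: tens_linear1.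
- move=> eta eta' z z' xi xi' geta geta' bxi bxi'; rewrite inner_tens //.
  have := base_commute (module_adjoint_comp hbeta bxi bxi')
    (module_adjoint_comp hgamma geta geta').
  by move=> /(congr1 (fun U : boundedOp b b => U z')) /= ->.
- rewrite -[RHS](tens_total HK); congr closed_span; apply/seteqP.
  split=> w [x [z [y [hx hy ->]]]]; by exists y, z, x.
Defined.

End Flip.

(** * The operators [ket1] and the compatibility of the two module structures *)

Section Bimodule.
Variables (R : realType) (b : CstarBase R) (H K : hilbertType R).
Variables (beta : set (boundedOp b H)) (gamma : set (boundedOp b K)).
Hypothesis hbeta : is_Cstar_module b beta.
Hypothesis hgamma : is_Cstar_module (opposite b) gamma.
Variable HK : relTensor beta gamma.

Let HKf := flip_tensor hbeta hgamma HK.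

Lemma ket1P xi eta z : beta xi -> gamma eta ->
  ket1 HK xi (eta z) = tens HK xi z eta.
Proof. exact: (ket2P (b := opposite b) hgamma hbeta HKf). Qed.

Lemma ket1_norm xi : beta xi -> rnorm (ket1 HK xi) <= rnorm xi.
Proof. exact: (ket2_norm (b := opposite b) hgamma hbeta HKf). Qed.

Lemma ket1_linear c xi xi' : beta xi -> beta xi' ->
  ket1 HK (c *: xi + xi') = c *: ket1 HK xi + ket1 HK xi'.
Proof. exact: (ket2_linear (b := opposite b) hgamma hbeta HKf). Qed.

Section Invariance.
Variables (a : CstarBase R) (alpha : set (boundedOp a H)).
Hypothesis halpha : is_Cstar_module a alpha.
Hypothesis rho_alpha :
  closed_span (opmul (rho beta @` base_opp_alg b) alpha) = alpha.
Variable A : set (boundedOp a a).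
Hypothesis cA : A `<=` commutant (base_alg a).
Hypothesis rho_beta : closed_span (opmul (rho alpha @` A) beta) = beta.

Lemma rho_mem_beta x xi : A x -> beta xi -> beta (bcomp (rho alpha x) xi).
Proof.
move=> Ax bxi; rewrite -rho_beta; apply: subset_closed_span.
by exists (rho alpha x); [exists x|exists xi].
Qed.

(** Tested on the total vectors $\eta\zeta$, where [rho_ltensor_tens] applies because
    $\rho_\alpha(x)\xi$ stays in [beta]. *)
Lemma rho_ltensor_ket1 x xi : A x -> beta xi ->
  bcomp (rho (ltensor HK alpha) x) (ket1 HK xi) =
  ket1 HK (bcomp (rho alpha x) xi).
Proof.
move=> Ax bxi; have bxxi := rho_mem_beta Ax bxi.
apply: op_ext_total (module_total hgamma) _ => _ [eta geta [z _ <-]].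
rewrite [LHS]/= !ket1P //.
by apply: (rho_ltensor_tens hbeta hgamma HK halpha rho_alpha) => //; apply: cA.
Qed.

(** By [rho_ltensor_ket1] the action on $|\xi\rangle_1d$ only changes $\xi$, so
    $[\rho_\alpha(A)\beta]=\beta$ carries over. The set [A] is a parameter so that the result covers
    both $\mathfrak A$ acting over [opposite a] and $\mathfrak C^\dagger$ acting over [c]. *)
Lemma rho_ltensor_rtensor (L : hilbertType R) (delta : set (boundedOp L K)) :
  closed_span (opmul (rho (ltensor HK alpha) @` A) (rtensor HK delta)) =
  rtensor HK delta.
Proof.
have [bs bc _ _ _] := hbeta.
have mem xi d : beta xi -> delta d -> rtensor HK delta (bcomp (ket1 HK xi) d).
  move=> bxi dd; apply: subset_closed_span.
  by exists (ket1 HK xi); [exists xi|exists d].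
have rc := @closed_span_closed R _ (opmul (ket1 HK @` beta) delta).
have rs := @closed_span_subspace R _ (opmul (ket1 HK @` beta) delta).
apply/seteqP; split; apply: closed_span_min => //.
- move=> _ [_ [x Ax <-] [T hT <-]]; move: T hT.
  apply: bcompr_span => // _ [_ [xi bxi <-] [d dd <-]].
  by rewrite bcompA rho_ltensor_ket1 //; apply: mem => //; apply: rho_mem_beta.
- exact: closed_span_closed.
- exact: closed_span_subspace.
move=> _ [_ [xi bxi <-] [d dd <-]].
set Q := closed_span _.
have Qc : closed Q by exact: closed_span_closed.
have Qs : is_subspace Q by exact: closed_span_subspace.
have spxi : closed_span (opmul (rho alpha @` A) beta) xi by rewrite rho_beta.
(* The domain is [beta], where [ket1] is linear and contractive. *)
apply: (proj2 (closed_span_map (s := idfun) (D := beta) (Q := Q)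
  (f := fun xi => bcomp (ket1 HK xi) d) bc bs Qc Qs (rnorm_ge0 d)
  _ _ _ _ spxi)).
- by move=> c u v bu bv; rewrite ket1_linear // bcomp_linearl.
- move=> u bu; apply: le_trans (bcomp_norm _ _) _.
  by rewrite mulrC ler_wpM2l ?rnorm_ge0 ?ket1_norm.
- by move=> _ [_ [x Ax <-] [xi' bxi' <-]]; apply: rho_mem_beta.
move=> _ [_ [x Ax <-] [xi' bxi' <-]].
rewrite -rho_ltensor_ket1 // -bcompA; apply: subset_closed_span.
exists (rho (ltensor HK alpha) x); first by exists x.
by exists (bcomp (ket1 HK xi') d); first exact: mem.
Qed.

End Invariance.

End Bimodule.

Theorem proposition2p12 (R : realType) (a b c : CstarBase R)
  (H K : hilbertType R)
  (alpha : set (boundedOp a H)) (beta : set (boundedOp b H))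
  (gamma : set (boundedOp b K)) (delta : set (boundedOp c K))
  (H_module : is_Cstar_bimodule alpha beta)
  (K_module : is_Cstar_bimodule gamma delta)
  (HK : relTensor beta gamma) :
  [/\ is_Cstar_bimodule (ltensor HK alpha) (rtensor HK delta),
      forall x : boundedOp a a, commutant (base_opp_alg a) x ->
        rho (ltensor HK alpha) x = op_tens_id HK (rho alpha x)
    & forall y : boundedOp c c, commutant (base_alg c) y ->
        rho (rtensor HK delta) y = id_tens_op HK (rho delta y)].
Proof.
have [ha hb rA rB] := H_module; have [hg hd rB' rC] := K_module.
have ca : base_alg a `<=` commutant (base_alg (opposite a)).
  by move=> x hx y hy; exact: (base_commute hx hy).
have cc : base_opp_alg c `<=` commutant (base_alg c).
  by move=> x hx y hy; exact/esym/(base_commute hy hx).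
(* Up to conversion, [ltensor KH delta] is [rtensor HK delta] and [rtensor KH alpha] is
   [ltensor HK alpha], so each statement on the right-hand structure is a left-hand one for [KH]. *)
pose KH := flip_tensor hb hg HK.
split.
- split.
  + exact: (ltensor_module hb hg HK ha rB).
  + exact: (ltensor_module (b := opposite b) hg hb KH hd rB').
  + exact: (rho_ltensor_rtensor hb hg HK ha rB ca rA).
  + exact: (rho_ltensor_rtensor (b := opposite b) hg hb KH hd rB' cc rC).
- by move=> x cx; apply: (rho_ltensor hb hg HK ha rB (a := opposite a)).
- by move=> y cy; apply: (rho_ltensor (b := opposite b) hg hb KH hd rB').
Qed.
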